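(* Let $C$ be a compact convex subset of $\mathbb{R}^n$ with non-empty interior. Let $f:C\to\mathbb{R}$ be a convex function, and let $G:C\to\mathbb{R}^n$ be a continuous mapping such that $(f,G)$ satisfies Whitney's condition $$\lim_{|z-y|\to0^+}\frac{f(z)-f(y)-\langle G(y),z-y\rangle}{|z-y|}=0\quad\text{uniformly on }C,$$ i.e. for every $\varepsilon>0$ there is $\delta>0$ such that $|f(z)-f(y)-\langle G(y),z-y\rangle|\le\varepsilon|z-y|$ for all $y,z\in C$ with $|z-y|\leq\delta$. Then there exists a convex function $F\in C^1(\mathbb{R}^n)$ such that $F|_C=f$ and $(\nabla F)|_C=G$. *)

(* Defs.v *)
From HB Require Import structures.
From mathcomp Require Import all_boot all_order all_algebra.
From mathcomp Require Import all_classical all_reals all_analysis.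

Set Implicit Arguments.
Unset Strict Implicit.
Unset Printing Implicit Defensive.

Import GRing.Theory Num.Theory numFieldNormedType.Exports.

Local Open Scope classical_set_scope.
Local Open Scope ring_scope.

(* The library norm on 'rV[R]_n is the sup norm, hence the separate Euclidean
   one; both induce the topology that the library puts on 'rV[R]_n. *)
Definition dotp (R : realType) (n : nat) (u v : 'rV[R]_n) : R :=
  \sum_i u 0 i * v 0 i.

Definition enorm (R : realType) (n : nat) (u : 'rV[R]_n) : R :=
  Num.sqrt (dotp u u).

Definition gradient (R : realType) (n : nat) (F : 'rV[R]_n -> R)
    (x : 'rV[R]_n) : 'rV[R]_n :=
  \row_(i < n) ('D_(delta_mx 0 i) F x : R).

Definition classC1 (R : realType) (n : nat) (F : 'rV[R]_n -> R) : Prop :=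
  (forall x, differentiable F x) /\ continuous (gradient F).

(* Only the values of f and G on C matter. *)
Definition whitney (R : realType) (n : nat) (C : set 'rV[R]_n)
    (f : 'rV[R]_n -> R) (G : 'rV[R]_n -> 'rV[R]_n) : Prop :=
  forall e : R, 0 < e -> exists2 d : R, 0 < d &
    forall y z, C y -> C z -> enorm (z - y) <= d ->
      `|f z - f y - dotp (G y) (z - y)| <= e * enorm (z - y).

(* Main.v *)
From HB Require Import structures.
Require Import Defs.
From mathcomp Require Import all_boot all_order all_algebra.
From mathcomp Require Import ring lra.
From mathcomp Require Import all_classical all_reals all_analysis.
Import Order.TTheory GRing.Theory Num.Theory numFieldNormedType.Exports.

Local Open Scope classical_set_scope.
Local Open Scope ring_scope.

Set Implicit Arguments.
Unset Strict Implicit.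
Unset Printing Implicit Defensive.

(* Let gap y z = f y - f z - <G z, y - z>, which is nonnegative on C. Convexity
   of f together with Whitney's condition shows that a small gap forces G y and
   G z to be close, because C has interior points. Hence the functions
   h |-> <G z - G y, h> - gap y z are o(|h|) uniformly in y, z, and they have a
   common majorant phi with phi 0 = 0 and
   phi (h + k) + phi (h - k) - 2 phi h <= o(|k|), uniformly in h.
   F is the largest convex function below all the functions
   x |-> f y + <G y, x - y> + phi (x - y), y in C; the bound on second
   differences passes to F, which makes F of class C^1. The affine functions
   x |-> f z + <G z, x - z> lie below F and touch it at z, so F z = f z and the
   gradient of F at z is G z. *)

(** * Euclidean inner product and norm, compared with the sup norm *)

Section euclidean.
Variables (R : realType) (n : nat).
Implicit Types (u v w : 'rV[R]_n) (a : R).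

Lemma dotpDl u v w : dotp (u + v) w = dotp u w + dotp v w.
Proof. by rewrite -big_split; apply: eq_bigr => i _; rewrite mxE mulrDl. Qed.

Lemma dotpDr u v w : dotp w (u + v) = dotp w u + dotp w v.
Proof. by rewrite -big_split; apply: eq_bigr => i _; rewrite mxE mulrDr. Qed.

Lemma dotpZr a u v : dotp u (a *: v) = a * dotp u v.
Proof. by rewrite mulr_sumr; apply: eq_bigr => i _; rewrite mxE mulrCA. Qed.

Lemma dotpZl a u v : dotp (a *: u) v = a * dotp u v.
Proof. by rewrite mulr_sumr; apply: eq_bigr => i _; rewrite mxE mulrA. Qed.

Lemma dotpNr u v : dotp u (- v) = - dotp u v.
Proof. by rewrite -scaleN1r dotpZr mulN1r. Qed.

Lemma dotpNl u v : dotp (- u) v = - dotp u v.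
Proof. by rewrite -scaleN1r dotpZl mulN1r. Qed.

Lemma dotpBl u v w : dotp (u - v) w = dotp u w - dotp v w.
Proof. by rewrite dotpDl dotpNl. Qed.

Lemma dotpBr u v w : dotp w (u - v) = dotp w u - dotp w v.
Proof. by rewrite dotpDr dotpNr. Qed.

Lemma dotp0r u : dotp u 0 = 0.
Proof. by rewrite -(subrr u) dotpBr subrr. Qed.

Lemma dotp_delta u i : dotp u (delta_mx 0 i) = u 0 i.
Proof.
rewrite /dotp (bigD1 i)//= big1 ?addr0; first by rewrite mxE !eqxx mulr1.
by move=> j ji; rewrite mxE (negbTE ji) andbF mulr0.
Qed.

Lemma enorm_ge0 u : 0 <= enorm u.
Proof. exact: sqrtr_ge0. Qed.

Lemma sqr_enorm u : enorm u ^+ 2 = dotp u u.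
Proof. by rewrite sqr_sqrtr// sumr_ge0// => i _; rewrite -expr2 sqr_ge0. Qed.

Lemma enormZ a u : enorm (a *: u) = `|a| * enorm u.
Proof.
by rewrite /enorm dotpZl dotpZr mulrA -expr2 sqrtrM ?sqr_ge0// sqrtr_sqr.
Qed.

Lemma parallelogram u v :
  enorm (u + v) ^+ 2 + enorm (u - v) ^+ 2 = 2 * enorm u ^+ 2 + 2 * enorm v ^+ 2.
Proof. by rewrite !sqr_enorm !(dotpDl, dotpDr, dotpNl, dotpNr); ring. Qed.

Lemma norm_coord_le u i : `|u 0 i| <= `|u|.
Proof.
rewrite [leRHS]/Num.norm /= mx_normrE; apply/bigmax_geP; right.
by exists (0, i).
Qed.

Lemma norm_row_le u a : 0 <= a -> (forall i, `|u 0 i| <= a) -> `|u| <= a.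
Proof.
move=> a0 ua; rewrite [leLHS]/Num.norm /= mx_normrE.
apply/bigmax_leP; split => //.
by move=> -[i j] _ /=; rewrite ord1.
Qed.

Lemma norm_dotp_le u v : `|dotp u v| <= n%:R * (`|u| * `|v|).
Proof.
apply: (le_trans (ler_norm_sum _ _ _)).
rewrite mulr_natl -[X in _ *+ X]card_ord -sumr_const; apply: ler_sum => i _.
by rewrite normrM ler_pM// norm_coord_le.
Qed.

Lemma norm_le_enorm u : `|u| <= enorm u.
Proof.
apply: norm_row_le => [|i]; first exact: enorm_ge0.
rewrite -sqrtr_sqr ler_wsqrtr// expr2 /dotp (bigD1 i)//= lerDl.
rewrite sumr_ge0// => j _.
by rewrite -expr2 sqr_ge0.
Qed.

(** The crude factor [n.+1] stays positive for [n = 0], so that constants can later be divided by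
    it. *)
Lemma enorm_le_norm u : enorm u <= n.+1%:R * `|u|.
Proof.
have n0 : 0 <= n.+1%:R * `|u| by rewrite mulr_ge0.
rewrite -(@ler_pXn2r _ 2)// ?nnegrE ?enorm_ge0// sqr_enorm exprMn.
apply: (le_trans (ler_norm _)); apply: (le_trans (norm_dotp_le u u)).
rewrite -expr2 ler_wpM2r ?sqr_ge0// -natrX ler_nat.
by rewrite expnS expn1 (leq_trans (leqnSn n))// leq_pmulr.
Qed.

End euclidean.

(** * Convex functions: segments, envelopes and supporting slopes *)

Section convexity.
Variables (R : realType) (V : lmodType R).
Implicit Types (x y v : V) (t : R) (u F : V -> R).

Lemma convex_combE x y t (t0 : 0 <= t) (t1 : t <= 1) :
  conv (Itv01 t0 t1) (y : convex_lmodType V) x = x + t *: (y - x).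
Proof.
by rewrite /conv/= scalerBl scale1r scalerBr addrCA.
Qed.

Lemma convex_set_segment (A : set V) x y t : convex_set A -> A x -> A y ->
  0 <= t <= 1 -> A (x + t *: (y - x)).
Proof.
move=> Ac Ax Ay /andP[t0 t1]; have := Ac y x (Itv01 t0 t1).
by rewrite convex_combE => /(_ (mem_set Ay) (mem_set Ax)) /set_mem.
Qed.

Lemma convex_function_segment (A : set V) u x y t : convex_function A u ->
  A x -> A y -> 0 <= t <= 1 -> u (x + t *: (y - x)) <= u x + t * (u y - u x).
Proof.
move=> uc Ax Ay /andP[t0 t1].
have := uc (Itv01 t0 t1) y x (mem_set Ay) (mem_set Ax).
rewrite convex_combE => /le_trans; apply; rewrite convRE/= /unstable.onem.
lra.
Qed.

Definition convexR u := forall x y t, 0 <= t <= 1 ->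
  u (x + t *: (y - x)) <= u x + t * (u y - u x).

Lemma convex_functionT u : convex_function [set: V] u <-> convexR u.
Proof.
split=> [uc x y t t01|uc t x y _ _].
  exact: convex_function_segment uc I I t01.
have t0 : 0 <= t%:num by exact: ge0.
have t1 : t%:num <= 1 by exact: le1.
rewrite (_ : t = Itv01 t0 t1); last exact: val_inj.
rewrite convex_combE (le_trans (uc _ _ _ _)) ?t0// convRE/= /unstable.onem; lra.
Qed.

(* The function [x |-> (F (x + k) + F (x - k) - c) / 2] is convex and lies below
   every [b i], hence below the largest such function [F]. *)
Lemma convex_envelope (I : Type) (J : set I) (b : I -> V -> R) (u0 : V -> R) :
  J !=set0 -> convexR u0 -> (forall i x, J i -> u0 x <= b i x) ->
  exists F, [/\ convexR F, forall i x, J i -> F x <= b i x,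
    forall u, convexR u -> (forall i x, J i -> u x <= b i x) ->
      forall x, u x <= F x &
    forall k c,
      (forall i x, J i -> b i (x + k) + b i (x - k) <= 2 * b i x + c) ->
      forall x, F (x + k) + F (x - k) <= 2 * F x + c].
Proof.
move=> [i0 Ji0] u0c u0b.
pose U := [set u | convexR u /\ forall i x, J i -> u x <= b i x].
pose S x := [set u x | u in U].
have US x : has_sup (S x).
  split; first by exists (u0 x), u0.
  by exists (b i0 x) => _ [u [_ ub] <-]; exact: ub.
pose F x := sup (S x).
have Fub u x : U u -> u x <= F x.
  by move=> Uu; apply: (ub_le_sup (US x).2); exists u.
have Fle x a : (forall u, U u -> u x <= a) -> F x <= a.
  by move=> ua; apply: (ge_sup (US x).1) => _ [u Uu <-]; exact: ua.
have Fb i x : J i -> F x <= b i x by move=> Ji; apply: Fle => u [_]; exact.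
have Fc : convexR F.
  move=> x y t /andP[t0 t1]; apply: Fle => u Uu.
  have t01 : 0 <= t <= 1 by rewrite t0.
  have := Uu.1 x y t t01; have := Fub u x Uu; have := Fub u y Uu; nra.
exists F; split => // [u uc ub x|k c bkc x]; first exact: Fub.
suff : U (fun x => (F (x + k) + F (x - k) - c) / 2) by move=> /(Fub _ x); lra.
split=> [y z t t01|i y Ji].
  have := Fc (y + k) (z + k) t t01; have := Fc (y - k) (z - k) t t01.
  have shift a : y + a + t *: (z + a - (y + a)) = y + t *: (z - y) + a.
    by rewrite opprD addrACA subrr addr0 addrAC.
  by rewrite !shift; lra.
by have := bkc i y Ji; have := Fb i (y + k) Ji; have := Fb i (y - k) Ji; lra.
Qed.

(** By convexity every backward difference quotient along [v] is at most every forward one; [p] is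
    the supremum of the backward ones. *)
Lemma convex_slopes F x v : convexR F ->
  exists p, forall s, F x + s * p <= F (x + s *: v).
Proof.
move=> Fc.
have slope s t : 0 < s -> 0 < t ->
    (F x - F (x - s *: v)) / s <= (F (x + t *: v) - F x) / t.
  move=> s0 t0; rewrite ler_pdivrMr// mulrAC ler_pdivlMr//.
  have st0 : 0 < s + t by lra.
  (* With this weight the segment from [x - s *: v] to [x + t *: v] passes through [x]. *)
  have r01 : 0 <= s / (s + t) <= 1.
    apply/andP; split; first by rewrite divr_ge0// ltW.
    by rewrite ler_pdivrMr// mul1r lerDl ltW.
  have := Fc (x - s *: v) (x + t *: v) _ r01.
  rewrite (_ : _ + _ *: _ = x); last first.
    rewrite opprB [s *: v - x]addrC addrACA subrr add0r -scalerDl scalerA.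
    by rewrite (addrC t) divfK ?gt_eqF// subrK.
  rewrite -(ler_pM2r st0) mulrDl mulrAC divfK ?gt_eqF//.
  by lra.
pose D := [set (F x - F (x - s *: v)) / s | s in [set s : R | 0 < s]].
have Dub t : 0 < t -> ubound D ((F (x + t *: v) - F x) / t).
  by move=> t0 _ [s s0 <-]; exact: slope.
have D0 : D !=set0 by exists ((F x - F (x - 1 *: v)) / 1), 1 => /=.
exists (sup D) => s; have [s0|s0|->] := ltgtP s 0.
- have : (F x - F (x - (- s) *: v)) / (- s) <= sup D.
    apply: ub_le_sup; first by exists ((F (x + 1 *: v) - F x) / 1); exact: Dub.
    by exists (- s) => //=; rewrite oppr_gt0.
  by rewrite scaleNr opprK ler_pdivrMr ?oppr_gt0//; lra.
- have := ge_sup D0 (Dub _ s0).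
  by rewrite ler_pdivlMr//; lra.
- by rewrite mul0r scale0r !addr0.
Qed.

End convexity.

(** * Slopes of a convex function with uniformly small second differences *)

Section smooth_convex.
Variables (R : realType) (V : normedModType R) (F : V -> R).
Hypothesis Fc : convexR F.
Hypothesis Fs : forall e, 0 < e -> exists2 d, 0 < d &
  forall k, `|k| <= d -> forall x, F (x + k) + F (x - k) <= 2 * F x + e * `|k|.

Definition is_slope x v p := forall s, F x + s * p <= F (x + s *: v).

(** The supporting inequality at [- s], inserted in the second-difference bound, becomes an upper
    bound at [s]. *)
Lemma slope_ub e : 0 < e -> exists2 d, 0 < d &
  forall x v p s, is_slope x v p -> `|s *: v| <= d ->
    F (x + s *: v) <= F x + s * p + e * `|s *: v|.
Proof.
move=> /Fs[d d0 dF]; exists d => // x v p s /(_ (- s)) xvp /dF/(_ x).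
by move: xvp; rewrite scaleNr; lra.
Qed.

(** For a suitable [s > 0], [s * q <= F (x + s *: v) - F x <= s * p + s * e], so [q <= p + e]; the
    roles of [p] and [q] are symmetric. *)
Lemma slope_uniq x v p q : is_slope x v p -> is_slope x v q -> p = q.
Proof.
wlog suff : p q / is_slope x v p -> is_slope x v q -> q <= p.
  by move=> H xp xq; apply/eqP; rewrite eq_le !H.
move=> xp xq; apply/ler_addgt0Pr => e e0.
have v1 : 0 < `|v| + 1 by rewrite ltr_pwDr.
have /slope_ub[d d0 H] : 0 < e / (`|v| + 1) by rewrite divr_gt0.
pose s := d / (`|v| + 1).
have s0 : 0 < s by rewrite divr_gt0.
have /(H _ _ _ s xp) : `|s *: v| <= d.
  by rewrite normrZ gtr0_norm// /s mulrAC ler_pdivrMr// ler_pM2l//; lra.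
have : e / (`|v| + 1) * `|s *: v| <= s * e.
  rewrite normrZ gtr0_norm// mulrCA ler_pM2l// mulrAC ler_pdivrMr// ler_pM2l//.
  lra.
have := xq s.
move=> h1 h2 h3; rewrite -(ler_pM2l s0); lra.
Qed.

Lemma slopeZ x v p a : is_slope x v p -> is_slope x (a *: v) (a * p).
Proof. by move=> xp s; rewrite scalerA mulrA. Qed.

Lemma slopeN x v p : is_slope x v p -> is_slope x (- v) (- p).
Proof. by move=> xp; rewrite -scaleN1r -[- p]mulN1r; exact: slopeZ. Qed.

(** Since [x + s *: (v + w)] is the midpoint of [x + (2 * s) *: v] and [x + (2 * s) *: w], convexity
    and [slope_ub] give [r <= p + q]; reversing all directions gives the other inequality. *)
Lemma slopeD x v w p q r : is_slope x v p -> is_slope x w q ->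
  is_slope x (v + w) r -> r = p + q.
Proof.
wlog suff : v w p q r / is_slope x v p -> is_slope x w q ->
    is_slope x (v + w) r -> r <= p + q.
  move=> H xp xq xr; apply/eqP; rewrite eq_le (H v w)//=.
  have := H (- v) (- w) _ _ (- r) (slopeN xp) (slopeN xq).
  by rewrite -opprD => /(_ (slopeN xr)); lra.
move=> xp xq xr; apply/ler_addgt0Pr => e e0.
set m := `|v| + `|w| + 1.
have m0 : 0 < m by rewrite ltr_pwDr.
have /slope_ub[d d0 H] : 0 < e / m by rewrite divr_gt0.
pose s := d / m / 2.
have s0 : 0 < s by rewrite !divr_gt0.
have sE : 2 * s * m = d by rewrite /s; field; rewrite gt_eqF.
have s20 : 0 < 2 * s by lra.
have sn u : `|(2 * s) *: u| = 2 * s * `|u| by rewrite normrZ gtr0_norm.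
have bound u a : `|u| <= m -> is_slope x u a ->
    F (x + (2 * s) *: u) <= F x + 2 * s * a + e / m * (2 * s * `|u|).
  move=> um xu; rewrite -sn; apply: H xu _.
  by rewrite sn -sE ler_pM2l.
have h1 : F (x + (2 * s) *: v) <= F x + 2 * s * p + e / m * (2 * s * `|v|).
  by apply: bound xp; rewrite /m; have := normr_ge0 w; lra.
have h2 : F (x + (2 * s) *: w) <= F x + 2 * s * q + e / m * (2 * s * `|w|).
  by apply: bound xq; rewrite /m; have := normr_ge0 v; lra.
have h3 : F (x + s *: (v + w)) <=
    (F (x + (2 * s) *: v) + F (x + (2 * s) *: w)) / 2.
  have h01 : 0 <= (1 / 2 : R) <= 1 by apply/andP; split; lra.
  have := Fc (x + (2 * s) *: v) (x + (2 * s) *: w) h01.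
  rewrite (_ : _ + _ *: _ = x + s *: (v + w)); first by lra.
  rewrite opprD addrACA subrr add0r -scalerBr scalerA scalerBr -addrA.
  congr (_ + _).
  rewrite (_ : 1 / 2 * (2 * s) = s); last by field.
  by rewrite addrCA -scalerBl (_ : 2 * s - s = s) ?scalerDr 1?addrC//; ring.
have h4 : e / m * (`|v| + `|w|) <= e.
  by rewrite mulrAC ler_pdivrMr// ler_pM2l// /m; lra.
have := xr s => h5; rewrite -(ler_pM2l s0).
have : s * (e / m * (`|v| + `|w|)) <= s * e by rewrite ler_pM2l.
lra.
Qed.

End smooth_convex.

(** * The linear form [dotp a] as a differential *)

Section dotp_linear.
Variables (R : realType) (n : nat) (a : 'rV[R]_n).

Let dotp_is_linear : linear (dotp a : 'rV[R]_n -> R).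
Proof. by move=> k u v; rewrite dotpDr dotpZr. Qed.

HB.instance Definition _ := GRing.isLinear.Build R 'rV[R]_n R _ (dotp a)
  dotp_is_linear.

Lemma continuous_dotp : continuous (dotp a : 'rV[R]_n -> R).
Proof.
apply: bounded_linear_continuous; apply/ex_bound.
exists (n%:R * (`|a| * 1)).
apply/(@nbhs_normP _ 'rV[R]_n); exists 1 => //= h /=.
rewrite sub0r normrN => h1.
by rewrite (le_trans (norm_dotp_le _ _))// ler_wpM2l// ler_wpM2l// ltW.
Qed.

Lemma diff_dotp (F : 'rV[R]_n -> R) x :
  (forall e, 0 < e -> exists2 d, 0 < d & forall h, `|h| <= d ->
     `|F (x + h) - F x - dotp a h| <= e * `|h|) ->
  differentiable F x /\ gradient F x = a.
Proof.
move=> Fe.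
have E : F \o shift x = cst (F x) + dotp a +o_ (0 : 'rV[R]_n) id.
  apply/eqaddoP => e /Fe[d d0 Fd].
  apply/(@nbhs_normP _ 'rV[R]_n); exists d => //= h /=.
  rewrite sub0r normrN => /ltW /Fd.
  by rewrite !fctE /= [h + x]addrC opprD addrA.
have dF : differentiable F x.
  apply/diff_locallyP; have dE := diff_unique continuous_dotp E.
  by rewrite dE; split => //; exact: continuous_dotp.
split => //; apply/rowP => i; rewrite mxE deriveE//.
by rewrite (diff_unique continuous_dotp E); exact: dotp_delta.
Qed.

End dotp_linear.

(** * Subgradients and continuity of the gradient *)

Section smooth_convex_C1.
Variables (R : realType) (n : nat) (F : 'rV[R]_n -> R).
Hypothesis Fc : convexR F.
Hypothesis Fs : forall e, 0 < e -> exists2 d, 0 < d &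
  forall k, `|k| <= d -> forall x, F (x + k) + F (x - k) <= 2 * F x + e * `|k|.

Definition is_subgradient x a := forall h, F x + dotp a h <= F (x + h).

Lemma subgradient_slope x a v : is_subgradient x a -> is_slope F x v (dotp a v).
Proof. by move=> xa s; rewrite -dotpZr. Qed.

(** Uniqueness of slopes makes the chosen slope linear in the direction, so its values on the
    standard basis form the subgradient. *)
Lemma ex_subgradient x : exists a, is_subgradient x a.
Proof.
have /choice[g gP] : forall v, exists p, is_slope F x v p.
  by move=> v; exact: convex_slopes.
have gD v w : g (v + w) = g v + g w.
  by apply: (slopeD Fc Fs) (gP _) (gP _) (gP _).
have gZ a v : g (a *: v) = a * g v.
  by apply: (slope_uniq Fs (gP _)); exact: slopeZ.
have g0 : g 0 = 0 by rewrite -(scale0r 0) gZ mul0r.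
exists (\row_i g (delta_mx 0 i)) => h.
suff -> : dotp (\row_i g (delta_mx 0 i)) h = g h.
  by have := gP h 1; rewrite mul1r scale1r.
rewrite {2}(row_sum_delta h) (big_morph g gD g0); apply: eq_bigr => i _.
by rewrite gZ mxE mulrC.
Qed.

Lemma subgradient_ub e : 0 < e -> exists2 d, 0 < d & forall x a h,
  is_subgradient x a -> `|h| <= d -> F (x + h) <= F x + dotp a h + e * `|h|.
Proof.
move=> /(slope_ub Fs)[d d0 H]; exists d => // x a h xa hd.
by have := H x h _ 1 (subgradient_slope _ xa); rewrite scale1r mul1r; exact.
Qed.

Lemma subgradient_diff x a : is_subgradient x a ->
  differentiable F x /\ gradient F x = a.
Proof.
move=> xa; apply: diff_dotp => e /subgradient_ub[d d0 H].
exists d => // h hd.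
have := H x a h xa hd; have := xa h => h1 h2.
by rewrite ger0_norm; lra.
Qed.

Lemma gradient_subgradient x : is_subgradient x (gradient F x).
Proof.
by have [a xa] := ex_subgradient x; have [_ ->] := subgradient_diff xa.
Qed.

Lemma smooth_convex_C1 : classC1 F.
Proof.
split=> [x|x]; first by have [a /subgradient_diff[]] := ex_subgradient x.
apply/(@cvgrPdist_le _ _ _ (nbhs (x : 'rV[R]_n))) => e e0.
have /subgradient_ub[d d0 H] : 0 < e / 2 by rewrite divr_gt0.
apply/(@nbhs_normP _ 'rV[R]_n); exists d => //= y /= /ltW xyd.
(* [F (x + h)] is bounded above from [x] and below from [y]; the upper bound for [F x] from [y]
   removes the remaining terms. *)
have key h : `|h| <= d ->
    dotp (gradient F y - gradient F x) h <= e / 2 * d + e / 2 * d.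
  move=> hd; have := H x _ h (gradient_subgradient x) hd.
  have := H y _ (x - y) (gradient_subgradient y) xyd.
  have := gradient_subgradient y (x - y + h).
  rewrite addrA addrCA subrr addr0 dotpDr dotpBl.
  have : e / 2 * `|h| <= e / 2 * d by rewrite ler_pM2l// divr_gt0.
  have : e / 2 * `|x - y| <= e / 2 * d by rewrite ler_pM2l// divr_gt0.
  lra.
apply: norm_row_le => [|i]; first exact: ltW.
(* Testing [key] at plus and minus [d] times a basis vector bounds each coordinate by [e]. *)
have nd : `|d *: (delta_mx 0 i : 'rV[R]_n)| <= d.
  rewrite normrZ gtr0_norm// ger_pMr//; apply: norm_row_le => // j.
  by rewrite mxE eqxx /=; case: (j == i); rewrite ?normr1 ?normr0.
have := key _ nd; have := key (- (d *: delta_mx 0 i)).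
rewrite normrN dotpNr dotpZr dotp_delta => /(_ nd); rewrite !mxE => h1 h2.
by rewrite ler_norml; apply/andP; split; rewrite -(ler_pM2r d0); lra.
Qed.

End smooth_convex_C1.

(** * A common majorant with small second differences *)

Section gauge.
Variables (R : realType) (n : nat) (E : set ('rV[R]_n -> R)) (L : R).
Hypothesis L0 : 0 < L.
Hypothesis EL : forall u h, E u -> u h <= L * enorm h.
Hypothesis Eo : forall e, 0 < e -> exists2 d, 0 < d &
  forall u h, E u -> enorm h <= d -> u h <= e * enorm h.

(* [gauge h] is an infimum of parabolas [c + K |h|^2], i.e. a concave function of
   [|h|^2]; together with [gauge h = o(|h|)], this bounds its second
   differences. *)
Let Q := [set p : R * R | [/\ 0 <= p.1, 0 <= p.2 &
  forall u h, E u -> u h <= p.1 + p.2 * enorm h ^+ 2]].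

Definition gauge (h : 'rV[R]_n) : R :=
  inf [set p.1 + p.2 * enorm h ^+ 2 | p in Q].

(** The right side is the parabola in [s] tangent at [s = t] to the line of slope [2 * i * t]. *)
Let amgm (i t s : R) : 0 <= i -> 2 * i * t * s <= i * t ^+ 2 + i * s ^+ 2.
Proof. by move=> i0; have := mulr_ge0 i0 (sqr_ge0 (s - t)); lra. Qed.

Let QL t : 0 < t -> Q (L / (2 * t) * t ^+ 2, L / (2 * t)).
Proof.
move=> t0; have i0 : 0 <= L / (2 * t) by rewrite divr_ge0 ?ltW// mulr_gt0.
split=> //=; first by rewrite mulr_ge0// sqr_ge0.
move=> u h /EL/le_trans; apply; apply: le_trans (amgm t (enorm h) i0).
suff -> : 2 * (L / (2 * t)) * t = L by [].
by field; rewrite gt_eqF.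
Qed.

(** Up to [d] the parabola lies above the line of slope [e], which bounds [E] there; beyond [d] its
    quadratic term exceeds [L * enorm h] because [t <= e * d / (2 * L)]. *)
Let Qo e : 0 < e -> exists2 d, 0 < d &
  forall t, 0 < t -> t <= d -> Q (e / (2 * t) * t ^+ 2, e / (2 * t)).
Proof.
move=> e0; have [d d0 H] := Eo e0; exists (e * d / (2 * L)).
  by rewrite divr_gt0 ?mulr_gt0.
move=> t t0; rewrite ler_pdivlMr ?mulr_gt0// => td.
set i := e / (2 * t).
have i0 : 0 <= i by rewrite divr_ge0 ?ltW// mulr_gt0.
have ie : 2 * i * t = e by rewrite /i; field; rewrite gt_eqF.
split=> //=; first by rewrite mulr_ge0// sqr_ge0.
move=> u h Eu; have [hd|dh] := leP (enorm h) d.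
  apply: le_trans (H _ _ Eu hd) _; rewrite -ie; exact: amgm.
apply: le_trans (EL h Eu) _; apply: ler_wpDl.
  by rewrite mulr_ge0// sqr_ge0.
rewrite expr2 mulrA ler_wpM2r ?enorm_ge0//.
apply: (@le_trans _ _ (i * d)); last by rewrite ler_wpM2l// ltW.
rewrite -(ler_pM2r t0) -(@ler_pM2l _ 2)//.
suff -> : 2 * (i * d * t) = e * d by lra.
by rewrite -ie; ring.
Qed.

Let hasinf (h : 'rV[R]_n) : has_inf [set p.1 + p.2 * enorm h ^+ 2 | p in Q].
Proof.
split; first by exists (L / (2 * 1) * 1 ^+ 2 + L / (2 * 1) * enorm h ^+ 2);
  exists (L / (2 * 1) * 1 ^+ 2, L / (2 * 1)) => //; exact: QL.
by exists 0 => _ [p [p1 p2 _] <-]; rewrite addr_ge0// mulr_ge0// sqr_ge0.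
Qed.

Let gauge_le p h : Q p -> gauge h <= p.1 + p.2 * enorm h ^+ 2.
Proof. by move=> Qp; apply: (ge_inf (hasinf h).2); exists p. Qed.

Lemma gauge_ge0 h : 0 <= gauge h.
Proof.
apply: (lb_le_inf (hasinf h).1) => _ [p [p1 p2 _] <-].
by rewrite addr_ge0// mulr_ge0// sqr_ge0.
Qed.

Lemma gauge_ub u h : E u -> u h <= gauge h.
Proof.
by move=> Eu; apply: (lb_le_inf (hasinf h).1) => _ [p [_ _ pE] <-]; exact: pE.
Qed.

Lemma gauge_lin h : 0 < enorm h -> gauge h <= L * enorm h.
Proof.
move=> h0; have /gauge_le - /(_ h)/le_trans := QL h0; apply.
by rewrite le_eqVlt; apply/orP; left; apply/eqP => /=; field; rewrite gt_eqF.
Qed.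

Lemma gauge_o e : 0 < e -> exists2 d, 0 < d &
  forall h, enorm h <= d -> gauge h <= e * enorm h.
Proof.
move=> e0; have [d d0 H] := Qo e0; exists d => // h hd.
have := enorm_ge0 h; rewrite le_eqVlt => /predU1P[h0|h0]; last first.
  have /gauge_le - /(_ h)/le_trans := H _ h0 hd; apply.
  by rewrite le_eqVlt; apply/orP; left; apply/eqP => /=; field; rewrite gt_eqF.
rewrite -h0 mulr0; apply/ler_addgt0Pr => a a0; rewrite add0r.
(* At the origin the parabola tangent at [t] has the value [t * e / 2], which is at most [a]. *)
pose t := Num.min d (2 * a / e).
have t0 : 0 < t by rewrite lt_min d0 divr_gt0// mulr_gt0.
have td : t <= d by rewrite ge_min lexx.
have /gauge_le - /(_ h)/le_trans := H t t0 td; apply => /=.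
rewrite -h0 expr0n mulr0 addr0.
have : t <= 2 * a / e by rewrite ge_min lexx orbT.
rewrite ler_pdivlMr// => ta.
suff -> : e / (2 * t) * t ^+ 2 = t * e / 2 by lra.
by field; rewrite gt_eqF.
Qed.

(** If [enorm h <= enorm k], each term is small by [gauge_o]. Otherwise a parabola almost optimal at
    [h] is used at [h + k] and [h - k], and the parallelogram law reduces its second difference to
    [2 * p.2 * enorm k ^+ 2]. *)
Lemma gauge_smooth e : 0 < e -> exists2 d, 0 < d & forall k, enorm k <= d ->
  forall h, gauge (h + k) + gauge (h - k) <= 2 * gauge h + e * enorm k.
Proof.
(* Of the six units [a * enorm k], two pay for the almost optimal parabola and four for its second
   difference. *)
move=> e0; pose a := e / 6; have a0 : 0 < a by rewrite divr_gt0.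
have [d d0 H] := gauge_o a0.
(* The first bound puts [2 * enorm k] below [d]; the second gives [L * enorm k <= a * d], used when
   [enorm h > d]. *)
exists (Num.min (d / 2) (a * d / L)).
  by rewrite lt_min !divr_gt0// mulr_gt0.
move=> k; rewrite le_min ler_pdivlMr// [_ <= a * d / L]ler_pdivlMr//.
move=> /andP[kd kL] h.
have := enorm_ge0 k; rewrite le_eqVlt => /predU1P[k0|k0].
  have -> : k = 0.
    by apply/eqP; rewrite -normr_le0 k0 norm_le_enorm.
  have := mulr_ge0 (ltW e0) (enorm_ge0 (0 : 'rV[R]_n)).
  by rewrite subr0 addr0; lra.
have N0 := enorm_ge0 h; have P := parallelogram h k.
have g0 := gauge_ge0 h.
set K := enorm k in kd kL k0 P *; set N := enorm h in N0 P.
have [NK|KN] := leP N K.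
  have small v : enorm v ^+ 2 <= 4 * K ^+ 2 -> gauge v <= a * (2 * K).
    move=> v2; have vK : enorm v <= 2 * K.
      have K4 : (2 * K) ^+ 2 = 4 * K ^+ 2 by ring.
      have K20 : 0 <= 2 * K by lra.
      by rewrite -(@ler_pXn2r _ 2)// ?nnegrE ?enorm_ge0// K4.
    apply: le_trans (H _ _) _; first by lra.
    by rewrite ler_pM2l.
  have NK2 : N ^+ 2 <= K ^+ 2 by rewrite ler_pXn2r// nnegrE// ltW.
  have := small (h + k); have := small (h - k).
  have := sqr_ge0 (enorm (h + k)); have := sqr_ge0 (enorm (h - k)).
  move=> p1 p2 s1 s2.
  have {}s1 : gauge (h - k) <= a * (2 * K) by apply: s1; lra.
  have {}s2 : gauge (h + k) <= a * (2 * K) by apply: s2; lra.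
  have aK : 0 < a * K by rewrite mulr_gt0.
  have -> : e = 6 * a by rewrite /a; field.
  lra.
have aK : 0 < a * K by rewrite mulr_gt0.
have [_ [p Qp <-] pK] := inf_adherent aK (hasinf h).
rewrite -/(gauge h) -/N in pK.
have := gauge_le (h + k) Qp; have := gauge_le (h - k) Qp.
have Np : 0 < N := lt_trans k0 KN.
have [p1 p2 _] := Qp.
(* After multiplication by [N ^+ 2], [p.2 * N ^+ 2] is bounded by [gauge h + a * K], where [gauge h]
   is at most [a * N] if [N <= d] and [L * N] otherwise. *)
have pK2 : p.2 * K ^+ 2 <= 2 * (a * K).
  rewrite -(ler_pM2r (mulr_gt0 Np Np)).
  have pN : p.2 * N ^+ 2 <= gauge h + a * K by lra.
  have KK : 0 < K ^+ 2 by rewrite exprn_gt0.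
  have : p.2 * N ^+ 2 * K ^+ 2 <= (gauge h + a * K) * K ^+ 2.
    by rewrite ler_pM2r.
  have KN2 : K ^+ 2 <= N ^+ 2 by rewrite ler_pXn2r ?nnegrE ?ltW//.
  have : a * K * K ^+ 2 <= a * K * N ^+ 2 by rewrite ler_pM2l.
  suff : gauge h * K ^+ 2 <= a * K * N ^+ 2 by lra.
  have NKN : N * K <= N * N by rewrite ler_pM2l// ltW.
  have [Nd|dN] := leP N d.
    have : gauge h * K ^+ 2 <= a * N * K ^+ 2 by rewrite ler_pM2r//; exact: H.
    have : a * K * (N * K) <= a * K * (N * N) by rewrite ler_pM2l.
    lra.
  have : gauge h * K ^+ 2 <= L * N * K ^+ 2.
    by rewrite ler_pM2r//; exact: gauge_lin.
  have : (K * L) * (N * K) <= (a * d) * (N * K) by rewrite ler_pM2r// mulr_gt0.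
  have : (a * d) * (N * K) <= (a * N) * (N * K).
    by rewrite ler_pM2r ?mulr_gt0// ler_pM2l// ltW.
  lra.
have -> : e = 6 * a by rewrite /a; field.
move: P => /(congr1 (fun z => p.2 * z)); rewrite !mulrDr.
lra.
Qed.

End gauge.

(** * The gap between [f] and its prescribed tangents *)

Section gap.
Variables (R : realType) (n : nat) (C : set 'rV[R]_n).
Variables (f : 'rV[R]_n -> R) (G : 'rV[R]_n -> 'rV[R]_n).
Hypothesis Cc : forall x y t, C x -> C y -> 0 <= t <= 1 -> C (x + t *: (y - x)).
Hypothesis fc : forall x y t, C x -> C y -> 0 <= t <= 1 ->
  f (x + t *: (y - x)) <= f x + t * (f y - f x).
Hypothesis Cb : exists2 d, 0 < d & forall x y, C x -> C y -> enorm (y - x) <= d.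
Hypothesis fG : whitney C f G.

(** The Bregman divergence of [f], with [G] as gradient. *)
Definition gap y z := f y - f z - dotp (G z) (y - z).

(** As [C] is bounded, one step size [s] serves all pairs of points. *)
Lemma whitney_segment e : 0 < e -> exists2 s, 0 < s <= 1 & forall y v,
  C y -> C v -> `|f (y + s *: (v - y)) - f y - s * dotp (G y) (v - y)| <= e * s.
Proof.
move=> e0; have [d d0 Cd] := Cb.
have [r r0 W] := fG (divr_gt0 e0 d0).
have s0 : 0 < Num.min 1 (r / d) by rewrite lt_min ltr01 divr_gt0.
have s1 : Num.min 1 (r / d) <= 1 by rewrite ge_min lexx.
have sr : Num.min 1 (r / d) * d <= r.
  by rewrite -ler_pdivlMr// ge_min lexx orbT.
move: (Num.min _ _) s0 s1 sr => s s0 s1 sr; exists s; first by rewrite s0.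
move=> y v Cy Cv; have s01 : 0 <= s <= 1 by rewrite ltW.
have sv : enorm (s *: (v - y)) <= s * d.
  by rewrite enormZ gtr0_norm// ler_pM2l// Cd.
have := W y _ Cy (Cc Cy Cv s01).
rewrite addrAC subrr add0r dotpZr => /(_ (le_trans sv sr))/le_trans; apply.
rewrite [leRHS](_ : _ = e / d * (s * d)); last by field; rewrite gt_eqF.
by rewrite ler_pM2l// divr_gt0.
Qed.

(** Whitney's condition near [z] and convexity on the segment to [y] give
    [dotp (G z) (y - z) <= f y - f z + e] for every [e > 0]. *)
Lemma gap_ge0 y z : C y -> C z -> 0 <= gap y z.
Proof.
move=> Cy Cz; rewrite /gap subr_ge0; apply/ler_addgt0Pr => e e0.
have [s s01 H] := whitney_segment e0.
have [s0 s1] := andP s01.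
have := H z y Cz Cy; rewrite ler_norml => /andP[h _].
have s01' : 0 <= s <= 1 by rewrite ltW.
have := fc Cz Cy s01' => h'; rewrite -(ler_pM2l s0); lra.
Qed.

(* With [z] as origin, [y] almost minimises [f - <G z, .>], which is nonnegative
   and flat at [z]; differentiability at [y] bounds [<G y - G z, v - y>] below,
   and differentiability at [z] bounds [<G y - G z, v - z>] above. *)
Lemma gap_small_dotp e : 0 < e -> exists2 r, 0 < r & forall y z v,
  C y -> C z -> C v -> gap y z <= r -> `|dotp (G y - G z) (v - z)| <= e.
Proof.
move=> e0; have e2 : 0 < e / 2 by rewrite divr_gt0.
have [t /andP[t0 t1] Ht] := whitney_segment e2.
(* In [lower], one share [e * t / 4] pays for Whitney's condition at [y] and another for
   [gap y z]. *)
have a0 : 0 < e * t / 4 by rewrite divr_gt0// mulr_gt0.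
have [s /andP[s0 s1] Hs] := whitney_segment a0.
exists (e * t / 4 * s); first by rewrite mulr_gt0.
move=> y z v Cy Cz Cv gr.
have t01 : 0 <= t <= 1 by rewrite ltW.
have s01 : 0 <= s <= 1 by rewrite ltW.
have lower w : C w -> - (e * t / 2) <= dotp (G y - G z) (w - y).
  move=> Cw; have := Hs y w Cy Cw; rewrite ler_norml => /andP[_ h1].
  have := gap_ge0 (Cc Cy Cw s01) Cz.
  rewrite /gap [y + _ - z]addrAC.
  rewrite [dotp _ (y - z + _)]dotpDr dotpZr => h2.
  by rewrite /gap in gr; rewrite -(ler_pM2l s0) dotpBl; lra.
have zy : dotp (G y - G z) (z - y) <= - gap y z.
  have := gap_ge0 Cz Cy; rewrite /gap dotpBl !dotpBr; lra.
have g0 := gap_ge0 Cy Cz.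
have vz w : dotp w (v - z) = dotp w (v - y) - dotp w (z - y).
  by rewrite -dotpBr opprB addrA subrK.
have et : e * t <= e by rewrite ger_pMr.
rewrite ler_norml; apply/andP; split.
  by rewrite vz; have := lower v Cv; lra.
rewrite -(ler_pM2l t0).
have := Ht z v Cz Cv; rewrite ler_norml => /andP[_ h1].
have := gap_ge0 (Cc Cz Cv t01) Cy.
rewrite /gap [z + _ - y]addrAC [dotp _ (z - y + _)]dotpDr dotpZr => h2.
have := lower z Cz; move: g0 h1 h2.
by rewrite /gap !(dotpBl, dotpBr); lra.
Qed.

Hypothesis Ci : exists v r, 0 < r /\ forall h, enorm h <= r -> C (v + h).

(** Subtracting the bounds of [gap_small_dotp] at [v + s *: h] and [v - s *: h], both in a ball
    inside [C], isolates the pairing with [h]. *)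
Lemma gap_small e : 0 < e -> exists2 r, 0 < r & forall y z h,
  C y -> C z -> gap y z <= r -> dotp (G z - G y) h <= e * enorm h.
Proof.
move=> e0; have [v [r [r0 Cv]]] := Ci.
have [a a0 H] := gap_small_dotp (mulr_gt0 e0 r0).
exists a => // y z h Cy Cz ga.
have := enorm_ge0 h; rewrite le_eqVlt => /predU1P[h0|h0].
  have -> : h = 0 by apply/eqP; rewrite -normr_le0 h0 norm_le_enorm.
  by rewrite dotp0r mulr_ge0 ?enorm_ge0// ltW.
pose s := r / enorm h; have s0 : 0 < s by rewrite divr_gt0.
have sh : s * enorm h = r by rewrite divfK// gt_eqF.
have sr : enorm (s *: h) <= r by rewrite enormZ gtr0_norm// sh.
have sr' : enorm (- s *: h) <= r by rewrite enormZ normrN gtr0_norm// sh.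
have := H y z _ Cy Cz (Cv _ sr) ga; have := H y z _ Cy Cz (Cv _ sr') ga.
rewrite !ler_norml => /andP[_ h1] /andP[h2 _].
rewrite -(ler_pM2l s0) mulrCA sh.
move: h1 h2; rewrite !(dotpBl, dotpBr, dotpDr, dotpZr); lra.
Qed.

(** A gap at most [r] is handled by [gap_small]; a larger one exceeds [L * enorm h] once
    [enorm h <= r / L], making the left side negative. *)
Lemma gap_uniform (L : R) : 0 < L ->
  (forall y z h, C y -> C z -> dotp (G z - G y) h <= L * enorm h) ->
  forall e, 0 < e -> exists2 d, 0 < d & forall y z h,
    C y -> C z -> enorm h <= d -> dotp (G z - G y) h - gap y z <= e * enorm h.
Proof.
move=> L0 GL e e0; have [r r0 H] := gap_small e0.
exists (r / L); first by rewrite divr_gt0.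
move=> y z h Cy Cz; rewrite ler_pdivlMr// => hr.
have g0 := gap_ge0 Cy Cz; have [gr|rg] := leP (gap y z) r.
  by have := H y z h Cy Cz gr; lra.
have := GL y z h Cy Cz; have := enorm_ge0 h => h1 h2.
by apply: (@le_trans _ _ 0); [lra|rewrite mulr_ge0// ltW].
Qed.

End gap.

(** * Geometry of [C] and construction of the extension *)

Lemma interior_enorm_ball (R : realType) (n : nat) (A : set 'rV[R]_n) :
  A° !=set0 -> exists v r, 0 < r /\ forall h, enorm h <= r -> A (v + h).
Proof.
move=> [v /(@nbhs_normP _ 'rV[R]_n)[r /= r0 rA]].
exists v, (r / 2); split=> [|h hr]; first by rewrite divr_gt0.
apply: rA => /=; rewrite opprD addNKr normrN.
by have := norm_le_enorm h; lra.
Qed.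

Lemma compact_enorm_bounded (R : realType) (n : nat) (A : set 'rV[R]_n) :
  compact A ->
  exists2 d, 0 < d & forall x y, A x -> A y -> enorm (y - x) <= d.
Proof.
move=> /(@compact_bounded _ 'rV[R]_n)/ex_strict_bound_gt0[M M0 AM].
exists (n.+1%:R * (M + M)); first by rewrite mulr_gt0// addr_gt0.
move=> x y Ax Ay; apply: le_trans (enorm_le_norm _) _; rewrite ler_wpM2l//.
by apply: le_trans (ler_normB _ _) _; rewrite lerD// ltW//; exact: AM.
Qed.

Theorem theorem1p7 (R : realType) (n : nat) (C : set 'rV[R]_n)
    (f : 'rV[R]_n -> R) (G : 'rV[R]_n -> 'rV[R]_n)
    (C_compact : compact C) (C_convex : convex_set C) (C_int : C° !=set0)
    (f_convex : convex_function C f)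
    (G_cont : {within C, continuous G})
    (fG_whitney : whitney C f G) :
  exists F : 'rV[R]_n -> R,
    [/\ convex_function setT F,
        classC1 F,
        {in C, F =1 f} &
        {in C, gradient F =1 G}].
Proof.
have Cc x y t : C x -> C y -> 0 <= t <= 1 -> C (x + t *: (y - x)).
  exact: convex_set_segment.
have fc x y t : C x -> C y -> 0 <= t <= 1 ->
    f (x + t *: (y - x)) <= f x + t * (f y - f x).
  exact: convex_function_segment.
have Cb := compact_enorm_bounded C_compact.
have Ci := interior_enorm_ball C_int.
have [L L0 GL] : exists2 L, 0 < L & forall y z h, C y -> C z ->
    dotp (G z - G y) h <= L * enorm h.
  (* [L] comes from the diameter of the compact image of [C] under [G]. *)
  have [d d0 Gd] := compact_enorm_bounded (continuous_compact G_cont C_compact).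
  exists (n.+1%:R * d); first by rewrite mulr_gt0.
  move=> y z h Cy Cz; apply: le_trans (ler_norm _) _.
  apply: le_trans (norm_dotp_le _ _) _; rewrite -mulrA.
  rewrite ler_pM ?mulr_ge0 ?ler_nat// ler_pM ?norm_le_enorm//.
  by apply: le_trans (norm_le_enorm _) _; apply: Gd; exact: imageP.
pose e y z h := dotp (G z - G y) h - gap f G y z.
pose E := [set u | exists y z, [/\ C y, C z & u = e y z]].
have EL u h : E u -> u h <= L * enorm h.
  move=> [y [z [Cy Cz ->]]]; rewrite /e.
  by have := GL y z h Cy Cz; have := gap_ge0 Cc fc Cb fG_whitney Cy Cz; lra.
have Eo a : 0 < a -> exists2 d, 0 < d &
    forall u h, E u -> enorm h <= d -> u h <= a * enorm h.
  move=> /(gap_uniform Cc fc Cb fG_whitney Ci L0 GL)[d d0 H].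
  by exists d => // _ h [y [z [Cy Cz ->]]]; exact: H.
pose phi := gauge E.
pose b y x := f y + dotp (G y) (x - y) + phi (x - y).
pose aff z x := f z + dotp (G z) (x - z).
(* The difference of [aff z x] and [f y + dotp (G y) (x - y)] is exactly [e y z (x - y)]. *)
have aff_le y z x : C y -> C z -> aff z x <= b y x.
  move=> Cy Cz; have : e y z (x - y) <= phi (x - y).
    by apply: (gauge_ub L0 EL); exists y, z.
  rewrite /e /aff /b /gap !(dotpBl, dotpBr); lra.
have affc z : convexR (aff z).
  move=> x y t _; rewrite /aff !(dotpBl, dotpBr, dotpDr, dotpZr); lra.
have [v /interior_subset Cv] := C_int.
have [F [Fc Fb Fmax Fsm]] :=
  convex_envelope (ex_intro _ v Cv) (affc v) (fun y x Cy => aff_le y v x Cy Cv).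
have affF z x : C z -> aff z x <= F x.
  by move=> Cz; apply: Fmax => [|y w Cy]; [exact: affc|exact: aff_le].
have Fs a : 0 < a -> exists2 d, 0 < d & forall k, `|k| <= d ->
    forall x, F (x + k) + F (x - k) <= 2 * F x + a * `|k|.
  move=> a0; have a1 : 0 < a / n.+1%:R by rewrite divr_gt0.
  have [d d0 H] := gauge_smooth L0 EL Eo a1.
  exists (d / n.+1%:R) => [|k]; first by rewrite divr_gt0.
  rewrite ler_pdivlMr// mulrC => kd x.
  have kn := enorm_le_norm k; apply: Fsm => y w Cy.
  have := H k (le_trans kn kd) (w - y).
  have : a / n.+1%:R * enorm k <= a * `|k|.
    by rewrite mulrAC ler_pdivrMr// -mulrA ler_pM2l// mulrC.
  (* The affine part of [b y] cancels in second differences, leaving those of [phi]. *)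
  rewrite /b -/phi ![w + _ - y]addrAC ![dotp _ (w - y + _)]dotpDr dotpNr.
  move: (a / _ * _) => c; lra.
have Ff y : C y -> F y = f y.
  move=> Cy; apply/eqP; rewrite eq_le; apply/andP; split.
    have phi0 : phi 0 <= 0.
      have [d d0 /(_ 0)] := gauge_o L0 EL Eo ltr01.
      by rewrite /enorm dotp0r sqrtr0 mulr0; apply; exact: ltW.
    by have := Fb y y Cy; rewrite /b subrr dotp0r; lra.
  by have := affF y y Cy; rewrite /aff subrr dotp0r addr0.
exists F; split.
- exact/convex_functionT.
- exact: smooth_convex_C1.
- by move=> y /set_mem; exact: Ff.
- move=> y /set_mem Cy.
  (* Since [F y = f y], the bound [aff y <= F] says that [G y] is a subgradient of [F] at [y]. *)
  apply: (subgradient_diff Fs _).2 => h.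
  by have := affF y (y + h) Cy; rewrite /aff (Ff y Cy) [y + h - y]addrC addKr.
Qed.
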